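(* Let $H$ be a loopless hypergraph having no included edges. If for every induced subhypergraph $H'$ of $H$ we have $\delta^*(H')=d_{H'}(v)$ for some $v\in V(H')$, then $\chi(H)\leq 1+\lambda_1(H)$, where $\lambda_1(H)$ is the largest eigenvalue of the unified matrix $\mathbf{U}(H)$.
   Context: A hypergraph $H$ consists of a finite non-empty vertex set $V(H)$ and a multiset $E(H)$ of non-empty subsets of $V(H)$, called edges; $m(e)$ is the multiplicity of $e$ in $E(H)$. A loop is an edge of cardinality one. An edge $e$ is included if there is an edge $e'\neq e$ of $H$ with $e\subset e'$. A subhypergraph $H'$ of $H$ is a hypergraph with $V(H')\subseteq V(H)$ and $E(H')\subseteq E(H)$; it is induced if $E(H')$ consists of all the edges of $H$ that are contained in $V(H')$. A 2-partition of a set $e$ is an unordered pair $\{S,S'\}$ of non-empty disjoint sets with $S\cup S'=e$; $S$ and $S'$ are called parts of $e$. $I(H)$ is the set of all parts of all edges of $H$ together with all singleton subsets of $V(H)$. For loopless $H$, the unified matrix $\mathbf{U}(H)$ is the matrix indexed by $I(H)$ whose $(S,S')$ entry is $m(e)$ if $\{S,S'\}$ is a 2-partition of an edge $e$ of $H$, and $0$ otherwise. For $S\in I(H)$, $d_H(S)$ is the number of edges $e\in E(H)$ (counted with multiplicity) with $S\subseteq e$; for a vertex $v$, $d_H(v)=d_H(\{v\})$ is its degree; and $\delta^*(H)=\min\{d_H(S): S\in I(H)\}$. A proper (weak) coloring of a loopless hypergraph is an assignment of colors to its vertices such that in every edge at least two vertices receive different colors; $\chi(H)$ is the minimum number of colors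 in a proper coloring of $H$. *)

(* Defs.v *)
From mathcomp Require Import all_boot all_order all_algebra.
From mathcomp Require Import reals.

Set Implicit Arguments.
Unset Strict Implicit.
Unset Printing Implicit Defensive.

Import Order.TTheory GRing.Theory Num.Theory.

(* The vertex set is a subset of an ambient finite type, so that a hypergraph
   and its subhypergraphs have the same type; the edge multiset is given by its
   multiplicity function. *)
Record hypergraph (T : finType) := Hypergraph {
  vertices : {set T};
  mult : {ffun {set T} -> nat};
  vertices_neq0 : vertices != set0;
  mult_edge : forall e, 0 < mult e -> (e != set0) && (e \subset vertices)
}.

Section Hypergraph.
Variable T : finType.
Implicit Types (H : hypergraph T) (S e : {set T}) (v : T).

Definition edges H : {set {set T}} := [set e | 0 < mult H e].

Definition loopless H : bool := [forall e in edges H, #|e| != 1].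

(* Distinctness is that of sets: repeated copies of an edge do not include one
   another. *)
Definition included H e : bool :=
  [exists e' in edges H, (e' != e) && (e \subset e')].

Definition no_included_edges H : bool :=
  [forall e in edges H, ~~ included H e].

Definition subhypergraph H' H : bool :=
  (vertices H' \subset vertices H) && [forall e, mult H' e <= mult H e].

Definition induced_subhypergraph H' H : bool :=
  subhypergraph H' H &&
  [forall e, mult H' e == if e \subset vertices H' then mult H e else 0].

Definition two_partition S S' e : bool :=
  [&& S != set0, S' != set0, [disjoint S & S'] & S :|: S' == e].

Definition part S e : bool := [exists S', two_partition S S' e].

Definition parts H : {set {set T}} :=
  [set S | [exists e in edges H, part S e]]
  :|: [set [set v] | v in vertices H].

Definition set_degree H S : nat :=
  \sum_(e in edges H | S \subset e) mult H e.

Definition degree H v : nat := set_degree H [set v].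

Lemma ex_set_degree H : exists n, [exists S in parts H, set_degree H S == n].
Proof.
have /set0Pn[v vH] := vertices_neq0 H.
exists (degree H v); apply/exists_inP; exists [set v]; last exact: eqxx.
by rewrite inE; apply/orP; right; apply: imset_f.
Qed.

Definition min_degree H : nat := ex_minn (ex_set_degree H).

Definition proper_coloring H k (c : {ffun T -> 'I_k}) : bool :=
  [forall e in edges H, [exists u in e, [exists v in e, c u != c v]]].

(* Colours of points outside [vertices H] are irrelevant, as no edge meets
   them. *)
Definition colorable H k : bool :=
  [exists c : {ffun T -> 'I_k}, proper_coloring H c].

Lemma ex_colorable H : loopless H -> exists k, colorable H k.
Proof.
move=> /forall_inP hl; exists #|T|; apply/existsP.
exists [ffun x => enum_rank x]; apply/forall_inP => e eH.
have e0 : e != set0.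
  by move: (eH); rewrite inE => /mult_edge /andP[].
have : 1 < #|e| by rewrite ltn_neqAle eq_sym hl //= card_gt0.
case/card_gt1P => u [v [ue ve uv]].
apply/exists_inP; exists u => //; apply/exists_inP; exists v => //.
by rewrite !ffunE (inj_eq enum_rank_inj).
Qed.

Definition chromatic_number H (hl : loopless H) : nat :=
  ex_minn (ex_colorable hl).

Local Open Scope ring_scope.

(* At most one edge [e] can be picked, namely [S :|: S']. *)
Definition unified_entry (R : realType) H S S' : R :=
  if [pick e in edges H | two_partition S S' e] is Some e
  then (mult H e)%:R else 0.

Definition unified_matrix (R : realType) H : 'M[R]_#|parts H| :=
  \matrix_(i, j) unified_entry R H (enum_val i) (enum_val j).

End Hypergraph.

Local Open Scope ring_scope.

Definition largest_eigenvalue (R : realType) n (A : 'M[R]_n) (l : R) : Prop :=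
  eigenvalue A l /\ forall x, eigenvalue A x -> x <= l.

(* Main.v *)
Require Import Defs.
From mathcomp Require Import all_boot all_order all_algebra.
From mathcomp Require Import sesquilinear spectral complex.
From mathcomp Require Import reals.

Set Implicit Arguments.
Unset Strict Implicit.
Unset Printing Implicit Defensive.

Import Order.TTheory GRing.Theory Num.Theory.
Local Open Scope ring_scope.

(** The all-ones vector turns row sums into a lower bound for the largest
    eigenvalue, and greedy coloring turns small degrees into few colors; the
    row sums of the unified matrix are degrees, which links the two.

    Row sums. If S lies in I(H), the edges e that properly contain S correspond
    to the sets S' = e \ S with {S, S'} a 2-partition of e, so row S of U(H)
    sums to the number of edges properly containing S. As H has neither loops
    nor included edges, no member of I(H) is itself an edge, and the row sum is
    the degree d(S) ([unified_row_sum]).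

    Eigenvalue bound. For real symmetric A, the largest eigenvalue l satisfies
    u A u^T <= l u u^T for all u ([symmetric_max_eigenvalue]). Let H' be a
    subhypergraph of H and u the indicator vector of I(H') inside I(H). Then
    u U(H) u^T is a sum over I(H') of entries that dominate those of U(H'),
    hence at least the sum of the degrees d_{H'}(S), hence at least
    delta^*(H') times u u^T = |I(H')|. So delta^*(H') <= l for every
    subhypergraph H' ([min_degree_sub_le]).

    Coloring. By hypothesis each induced H' then has a vertex of degree at most
    k = floor l. Remove such vertices one after the other and color them in the
    reverse order with k + 1 colors: an edge forbids at most one color for its
    last vertex, so a color is always available ([greedy_colorable]). *)

(** * The largest eigenvalue of a real symmetric matrix *)

Section SpectralForm.
Local Open Scope sesquilinear_scope.

Lemma hermitian_form_spectral (C : numClosedFieldType) n (A : 'M[C]_n)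
    (u : 'rV_n) : A \is normalmx ->
  (u *m A *m u^t*) 0 0 =
  \sum_i spectral_diag A 0 i * `|(u *m (spectralmx A)^t*) 0 i| ^+ 2.
Proof.
move=> /orthomx_spectralP AE; rewrite {1}AE.
rewrite (invmx_unitary (spectral_unitarymx A)).
set P := spectralmx A; set w := u *m P^t*.
have -> : u *m (P^t* *m diag_mx (spectral_diag A) *m P) *m u^t* =
    w *m diag_mx (spectral_diag A) *m w^t*.
  by rewrite /w trmx_mul map_mxM trmxCK !mulmxA.
rewrite mxE; apply: eq_bigr => i _.
rewrite mul_mx_diag normCK [w]lock !mxE -lock.
by rewrite [_ * spectral_diag _ _ _]mulrC mulrA.
Qed.

Lemma spectral_diag_eigenvalue (C : numClosedFieldType) n (A : 'M[C]_n) i :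
  A \is normalmx -> eigenvalue A (spectral_diag A 0 i).
Proof.
move=> /orthomx_spectralP AE; have Pu := spectral_unit A.
apply/eigenvalueP; exists (row i (spectralmx A)).
  rewrite -row_mul {2}AE !mulmxA mulmxV // mul1mx.
  by rewrite mul_diag_mx; apply/rowP => j; rewrite !mxE.
apply/negP => /eqP r0; have /row_freeP[B PB] : row_free (spectralmx A).
  by rewrite row_free_unit.
have := congr1 (fun M => (row i M) 0 i) PB.
by rewrite row_mul r0 mul0mx !mxE eqxx => /esym/eqP; rewrite oner_eq0.
Qed.

(** A real symmetric matrix is Hermitian over R[i], where the spectral theorem
    applies; its eigenvalues are real, so the largest one descends to R. *)
Lemma symmetric_max_eigenvalue (R : rcfType) n (A : 'M[R]_n) :
  (0 < n)%N -> A^T = A ->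
  exists2 l : R, eigenvalue A l &
    forall u : 'rV_n, (u *m A *m u^T) 0 0 <= l * (u *m u^T) 0 0.
Proof.
move=> n0 symA; pose f := real_complex R; pose AC := map_mx f A.
have ACherm : AC \is hermsymmx.
  apply: realsym_hermsym.
    by apply/is_hermitianmxP; rewrite expr0 scale1r map_mx_id // map_trmx symA.
  by apply/mxOverP => i j; rewrite mxE; apply/complex_realP; exists (A i j).
have ACn := hermitian_normalmx ACherm.
have dreal i : spectral_diag AC 0 i = f (complex.Re (spectral_diag AC 0 i)).
  by rewrite /f RRe_real //; apply/mxOverP/hermitian_spectral_diag_real.
pose d i := complex.Re (spectral_diag AC 0 i).
case: (arg_maxP (i0 := Ordinal n0) (P := xpredT) d isT) => i _ dmax.
exists (d i) => [|u].
  by move: (spectral_diag_eigenvalue i ACn); rewrite dreal eigenvalue_map.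
have uC : (map_mx f u)^t* = map_mx f u^T.
  by apply/matrixP => a b; rewrite !mxE; apply: conjc_real.
have formE (M : 'M[R]_n) : ((u *m M *m u^T) 0 0)%:C%C =
    (map_mx f u *m map_mx f M *m (map_mx f u)^t*) 0 0.
  by rewrite uC -!map_mxM [in RHS]mxE.
have normE : ((u *m u^T) 0 0)%:C%C =
    \sum_j `|(map_mx f u *m (spectralmx AC)^t*) 0 j| ^+ 2.
  (* The change of basis is unitary, so it preserves the norm of u. *)
  have := spectral_unitarymx AC; rewrite -trmxC_unitary => /unitarymxP PV.
  have -> : u *m u^T = u *m 1%:M *m u^T by rewrite mulmx1.
  rewrite formE map_mx1 -PV !mulmxA -mulmxA -map_mxM -trmx_mul mxE.
  by apply: eq_bigr => j _; rewrite normCK !mxE.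
have CM (x y : R) : (x * y)%:C%C = x%:C%C * y%:C%C by apply: (rmorphM f).
rewrite -lecR formE hermitian_form_spectral // CM normE mulr_sumr.
apply: ler_sum => j _.
by rewrite ler_wpM2r ?exprn_ge0 // dreal lecR; apply: dmax.
Qed.

End SpectralForm.

Lemma max_eigenvalue (R : rcfType) n (A : 'M[R]_n) (l : R) :
  (forall u : 'rV_n, (u *m A *m u^T) 0 0 <= l * (u *m u^T) 0 0) ->
  forall x, eigenvalue A x -> x <= l.
Proof.
move=> formA x /eigenvalueP[v vA v0].
have v_gt0 : 0 < (v *m v^T) 0 0.
  have sq j : v 0 j * v^T j 0 = v 0 j ^+ 2 by rewrite mxE expr2.
  have sq_ge0 j : 0 <= v 0 j * v^T j 0 by rewrite sq sqr_ge0.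
  rewrite lt_def mxE sumr_ge0 // andbT; apply: contra v0 => /eqP.
  move=> /(psumr_eq0P (fun j _ => sq_ge0 j)) vj0.
  by apply/eqP/rowP => j; rewrite mxE; apply/eqP; rewrite -sqrf_eq0 -sq vj0.
by have := formA v; rewrite vA -scalemxAl mxE ler_pM2r.
Qed.

(** The form at the indicator vector of [I] is the sum of all entries of the
    principal submatrix on [I], and the squared norm of that vector is [#|I|];
    so the average row sum of the submatrix is at most [l]. *)
Lemma row_sum_le_form_bound (R : realDomainType) n (A : 'M[R]_n) (l d : R)
    (I : {set 'I_n}) :
  (forall u : 'rV_n, (u *m A *m u^T) 0 0 <= l * (u *m u^T) 0 0) ->
  I != set0 -> (forall i, i \in I -> d <= \sum_(j in I) A i j) -> d <= l.
Proof.
move=> formA I0 dI; have cI : 0 < #|I|%:R :> R by rewrite ltr0n card_gt0.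
rewrite -(ler_pM2r cI).
pose u : 'rV[R]_n := \row_i (i \in I)%:R.
have uM (B : 'M[R]_n) : (u *m B *m u^T) 0 0 = \sum_(i in I) \sum_(j in I) B i j.
  rewrite exchange_big /= [LHS]mxE [RHS]big_mkcond; apply: eq_bigr => j _.
  rewrite !mxE; case: ifP => _; last by rewrite mulr0.
  rewrite mulr1 [RHS]big_mkcond; apply: eq_bigr => i _.
  by rewrite mxE; case: ifP => _; rewrite ?mul1r ?mul0r.
have uu : (u *m u^T) 0 0 = #|I|%:R.
  have -> : u *m u^T = u *m 1%:M *m u^T by rewrite mulmx1.
  rewrite uM -sum1_card natr_sum; apply: eq_bigr => i iI.
  rewrite (bigD1 i) //= mxE eqxx big1 ?addr0 // => j /andP[_ ji].
  by rewrite mxE eq_sym (negPf ji).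
move: (formA u); rewrite uu; apply: le_trans.
rewrite uM -sum1_card natr_sum mulr_sumr; apply: ler_sum => i iI.
by rewrite mulr1 dI.
Qed.

Section Combinatorics.
Variable T : finType.
Implicit Types (H : hypergraph T) (S e W : {set T}) (v : T).

(** * The unified matrix and its row sums *)

Lemma edge_neq0 H e : e \in edges H -> e != set0.
Proof. by rewrite inE => /mult_edge /andP[]. Qed.

Lemma edge_sub_vertices H e : e \in edges H -> e \subset vertices H.
Proof. by rewrite inE => /mult_edge /andP[]. Qed.

Lemma two_partition_sym S S' e : two_partition S S' e = two_partition S' S e.
Proof.
by rewrite /two_partition disjoint_sym setUC; case: (S != _) (S' != _) => [] [].
Qed.

(** The sum has at most one term; in this form entries can be summed over
    [S'] by exchanging the order of summation. *)
Lemma unified_entry_edges (R : realType) H S S' :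
  unified_entry R H S S' =
  \sum_(e in edges H | two_partition S S' e) (mult H e)%:R.
Proof.
rewrite /unified_entry; case: pickP => [e /andP[eH Se]|noe].
  rewrite (bigD1 e) ?eH //= big1 ?addr0 // => e' /andP[/andP[_ Se'] /eqP[]].
  case/and4P: Se => _ _ _ /eqP <-.
  by case/and4P: Se' => _ _ _ /eqP <-.
by rewrite big_pred0.
Qed.

Lemma unified_matrix_sym (R : realType) H :
  (unified_matrix R H)^T = unified_matrix R H.
Proof.
apply/matrixP => i j; rewrite !mxE !unified_entry_edges.
by apply: eq_bigl => e; rewrite two_partition_sym.
Qed.

Section Subhypergraph.
Variables (H' H : hypergraph T).
Hypothesis sub : subhypergraph H' H.

Lemma sub_mult e : (mult H' e <= mult H e)%N.
Proof. by case/andP: sub => _ /forallP. Qed.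

Lemma sub_edges : edges H' \subset edges H.
Proof.
by apply/subsetP => e; rewrite !inE => /leq_trans->; rewrite ?sub_mult.
Qed.

Lemma sub_parts : parts H' \subset parts H.
Proof.
case/andP: sub => subV _; apply/subsetP => S; rewrite !inE.
case/orP => [/exists_inP[e eH' Se]|/imsetP[v vH' ->]]; apply/orP; [left|right].
  by apply/exists_inP; exists e => //; apply: (subsetP sub_edges).
by apply: imset_f; apply: (subsetP subV).
Qed.

Lemma sub_loopless : loopless H -> loopless H'.
Proof.
by move=> /forall_inP lH; apply/forall_inP => e /(subsetP sub_edges) /lH.
Qed.

Lemma sub_no_included_edges : no_included_edges H -> no_included_edges H'.
Proof.
move=> /forall_inP nH; apply/forall_inP => e /(subsetP sub_edges) /nH.
apply: contra => /exists_inP[e' e'H ee']; apply/exists_inP; exists e' => //.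
exact: (subsetP sub_edges).
Qed.

Lemma sub_unified_entry (R : realType) S S' :
  unified_entry R H' S S' <= unified_entry R H S S'.
Proof.
rewrite !unified_entry_edges big_mkcond [leRHS]big_mkcond.
apply: ler_sum => e _; case: (two_partition S S' e); last by rewrite !andbF.
rewrite !andbT; case: ifP => [/(subsetP sub_edges) -> | _].
  by rewrite ler_nat sub_mult.
by case: ifP.
Qed.

End Subhypergraph.

(** A part of an edge e' is a proper subset of e', so it would be an included
    edge if it were an edge; a singleton edge would be a loop. *)
Lemma part_neq_edge H S e : loopless H -> no_included_edges H ->
  S \in parts H -> e \in edges H -> S != e.
Proof.
move=> /forall_inP lH /forall_inP nH SH eH; apply/eqP => Se.
move: SH; rewrite Se !inE => /orP[/exists_inP[e' e'H /existsP[S'']]|].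
  case/and4P => _ S''0 disj /eqP ee'.
  case/negP: (nH _ eH); apply/exists_inP; exists e' => //.
  rewrite -{2}ee' subsetUl andbT; apply: contra S''0 => /eqP e'e.
  move: disj; rewrite -setI_eq0 => /eqP I0; rewrite -I0.
  have /setIidPr-> // : S'' \subset e by rewrite -e'e -ee' subsetUr.
by case/imsetP => v _ ev; have := lH _ eH; rewrite ev cards1 eqxx.
Qed.

Lemma part_neq0 H S : S \in parts H -> S != set0.
Proof.
rewrite !inE => /orP[/exists_inP[e _ /existsP[S' /and4P[]]] //|].
by case/imsetP => v _ ->; apply/set0Pn; exists v; rewrite set11.
Qed.

Lemma two_partition_setD S S' e :
  two_partition S S' e = [&& S != set0, S \proper e & S' == e :\: S].
Proof.
apply/and4P/and3P => [[S0 S'0 disj /eqP <-]|[S0 pSe /eqP ->]].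
  move: disj; rewrite -setI_eq0 => /eqP disj.
  split=> //; last first.
    by rewrite setDUl setDv set0U; apply/eqP/esym/setDidPl;
      rewrite -setI_eq0 setIC disj.
  rewrite properE subsetUl /=; apply: contra S'0 => /subUsetP[_ S'S].
  by rewrite -disj; apply/eqP/esym/setIidPr.
split=> //.
- by rewrite setD_eq0; case/andP: pSe.
- by rewrite -setI_eq0 setIDA setIC setDIl setDv setI0.
by rewrite -{1}(setIidPr (proper_sub pSe)) setID.
Qed.

(** Each edge [e] containing [S] is counted once, by [S' = e :\: S]; the
    inclusion of [S] in [e] is proper by [part_neq_edge]. *)
Lemma unified_row_sum (R : realType) H S :
  loopless H -> no_included_edges H -> S \in parts H ->
  \sum_(S' in parts H) unified_entry R H S S' = (set_degree H S)%:R.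
Proof.
move=> lH nH SH; have S0 := part_neq0 SH.
have Sneq e (eH : e \in edges H) : S != e by apply: part_neq_edge eH.
rewrite /set_degree natr_sum.
rewrite (eq_bigr _ (fun S' _ => unified_entry_edges R H S S')).
rewrite (exchange_big_dep (mem (edges H))) /=; last by move=> ? ? _ /andP[].
rewrite [RHS]big_mkcondr; apply: eq_bigr => e eH.
under eq_bigl => S' do rewrite eH two_partition_setD S0 properEneq Sneq //=.
case: ifP => Se; last by rewrite big_pred0 // => S'; rewrite andbF.
rewrite (big_pred1 (e :\: S)) // => S' /=.
case: eqVneq => [->|_]; rewrite ?andbF //.
rewrite andbT !inE; apply/orP; left; apply/exists_inP; exists e => //.
apply/existsP; exists S; rewrite two_partition_sym two_partition_setD.
by rewrite S0 properEneq Sneq // Se eqxx.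
Qed.

(** * Minimum degrees are at most the largest eigenvalue *)

Lemma min_degree_le_set_degree H S :
  S \in parts H -> (min_degree H <= set_degree H S)%N.
Proof.
move=> SH; rewrite /min_degree; case: ex_minnP => m _; apply.
by apply/exists_inP; exists S.
Qed.

Lemma vertex_part H v : v \in vertices H -> [set v] \in parts H.
Proof. by move=> vH; rewrite inE imset_f ?orbT. Qed.

Lemma parts_neq0 H : parts H != set0.
Proof.
have /set0Pn[v vH] := vertices_neq0 H.
by apply/set0Pn; exists [set v]; apply: vertex_part.
Qed.

(** On the principal submatrix of U(H) indexed by I(H'), the entries dominate
    those of U(H'), whose row sums are degrees in H'. *)
Lemma min_degree_sub_le (R : realType) H H' (l : R) :
  loopless H -> no_included_edges H -> subhypergraph H' H ->
  (forall u : 'rV_#|parts H|,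
     (u *m unified_matrix R H *m u^T) 0 0 <= l * (u *m u^T) 0 0) ->
  (min_degree H')%:R <= l.
Proof.
move=> lH nH sub formH.
pose I := [set i : 'I_#|parts H| | enum_val i \in parts H'].
have partE S : (S \in parts H) && (S \in parts H') = (S \in parts H').
  by rewrite andb_idl // => /(subsetP (sub_parts sub)).
apply: (row_sum_le_form_bound (I := I) formH) => [|i].
  have /set0Pn[S SH'] := parts_neq0 H'.
  have SH := subsetP (sub_parts sub) _ SH'.
  by apply/set0Pn; exists (enum_rank_in SH S); rewrite inE enum_rankK_in.
rewrite inE => SH'; set S := enum_val i in SH'.
rewrite (eq_bigr (fun j => unified_entry R H S (enum_val j))); last first.
  by move=> j _; rewrite mxE.
rewrite (eq_bigl (fun j => enum_val j \in parts H')); last first.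
  by move=> j; rewrite inE.
rewrite -(big_enum_val_cond (fun S' => S' \in parts H')
  (unified_entry R H S)) /=.
rewrite (eq_bigl _ _ partE).
apply: (@le_trans _ _ (set_degree H' S)%:R).
  by rewrite ler_nat min_degree_le_set_degree.
have l' := sub_loopless sub lH; have n' := sub_no_included_edges sub nH.
rewrite -(unified_row_sum R l' n' SH').
by apply: ler_sum => S' _; apply: sub_unified_entry.
Qed.

(** * Greedy coloring *)

Section Restriction.
Variables (H : hypergraph T) (W : {set T}).
Hypothesis W0 : W != set0.

Definition restrict_mult : {ffun {set T} -> nat} :=
  [ffun e : {set T} => if e \subset W then mult H e else 0%N].

Lemma restrict_mult_edge e :
  (0 < restrict_mult e)%N -> (e != set0) && (e \subset W).
Proof. by rewrite ffunE; case: ifP => // _ /mult_edge /andP[-> _]. Qed.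

Definition restriction := Hypergraph W0 restrict_mult_edge.

Lemma induced_restriction :
  W \subset vertices H -> induced_subhypergraph restriction H.
Proof.
move=> WH; apply/andP; split; first (apply/andP; split=> //).
  by apply/forallP => e; rewrite ffunE; case: ifP.
by apply/forallP => e; rewrite ffunE.
Qed.

(** Parallel edges count once on the left: copies of an edge forbid the same
    color in the greedy coloring. *)
Lemma card_edges_at_le_degree v :
  (#|[set e in edges H | e \subset W & v \in e]| <= degree restriction v)%N.
Proof.
rewrite /degree /set_degree -sum1_card.
rewrite (eq_bigl (fun e => (e \in edges restriction) && ([set v] \subset e))).
  by apply: leq_sum => e /andP[]; rewrite inE.
move=> e; rewrite !inE ffunE sub1set andbA; congr (_ && _).
by case: ifP; rewrite ?andbT ?andbF.
Qed.

End Restriction.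

(** A vertex [v] of small degree is colored after the rest of [W]. For each edge
    at [v] it is enough to avoid the color of one chosen other vertex of that
    edge; this forbids at most [k] colors. *)
Lemma greedy_colorable H k : loopless H ->
  (forall W (W0 : W != set0), W \subset vertices H ->
     exists2 v, v \in W & (degree (restriction H W0) v <= k)%N) ->
  colorable H k.+1.
Proof.
move=> /forall_inP lH degH.
suff /(_ (vertices H) (subxx _))[c cP] : forall W, W \subset vertices H ->
    exists c : {ffun T -> 'I_k.+1}, forall e, e \in edges H -> e \subset W ->
      exists x y, [/\ x \in e, y \in e & c x != c y].
  apply/existsP; exists c; apply/forall_inP => e eH.
  have [x [y [xe ye cxy]]] := cP e eH (edge_sub_vertices eH).
  by apply/exists_inP; exists x => //; apply/exists_inP; exists y.
move=> W; have [n] := ubnP #|W|; elim: n W => // n IHn W cW WH.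
have [W0|W0] := eqVneq W set0.
  exists [ffun=> ord0] => e /edge_neq0 e0.
  by rewrite W0 subset0 (negPf e0).
have [v vW dv] := degH W W0 WH.
have [||c cP] := IHn (W :\ v).
- by move: cW; rewrite (cardsD1 v) vW.
- exact: subset_trans (subD1set _ _) WH.
pose E := [set e in edges H | e \subset W & v \in e].
have cE : (#|E| <= k)%N by apply: leq_trans (card_edges_at_le_degree H W0 v) dv.
(* The default [v] is never taken: an edge at [v] is not a loop. *)
pose rep e := odflt v [pick x in e :\ v].
have repP e : e \in E -> rep e \in e :\ v.
  rewrite inE /rep => /and3P[eH _ ve]; case: pickP => //= no.
  have := lH _ eH; rewrite (cardsD1 v) ve.
  by rewrite (_ : e :\ v = set0) ?cards0 //; apply/setP => x; rewrite no inE.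
pose forbidden := [set c (rep e) | e in E].
have /set0Pn[a] : ~: forbidden != set0.
  rewrite -card_gt0 cardsCs setCK card_ord subn_gt0 ltnS.
  exact: leq_trans (leq_imset_card _ _) cE.
rewrite inE => aF.
exists [ffun x => if x == v then a else c x] => e eH eW.
have [ve|ve] := boolP (v \in e).
  have eE : e \in E by rewrite inE eH eW.
  have := repP e eE; rewrite !inE => /andP[rv re].
  exists v, (rep e); split=> //; rewrite !ffunE eqxx (negPf rv).
  by apply: contra aF => /eqP->; apply: imset_f.
have [|x [y [xe ye cxy]]] := cP e eH; first by rewrite subsetD1 eW.
have neqv z : z \in e -> (z == v) = false by move/(memPn ve)/negbTE.
by exists x, y; split=> //; rewrite !ffunE !neqv.
Qed.

End Combinatorics.

(** * The bound on the chromatic number *)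

Theorem theorem9p6 (R : realType) (T : finType) (H : hypergraph T)
  (hl : loopless H) (hincl : no_included_edges H)
  (hdeg : forall H' : hypergraph T, induced_subhypergraph H' H ->
     exists2 v : T, v \in vertices H' & min_degree H' = degree H' v) :
  exists2 lambda1 : R, largest_eigenvalue (unified_matrix R H) lambda1
    & (chromatic_number hl)%:R <= 1 + lambda1.
Proof.
have p0 : (0 < #|parts H|)%N by rewrite card_gt0 parts_neq0.
have [l lA formA] := symmetric_max_eigenvalue p0 (unified_matrix_sym R H).
exists l; first by split=> //; apply: max_eigenvalue.
have deltal H' : induced_subhypergraph H' H -> (min_degree H')%:R <= l.
  by move=> /andP[sub _]; apply: min_degree_sub_le sub formA.
(* [truncn] is the floor of [l] only when [l] is nonnegative. *)
have l0 : 0 <= l.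
  apply: le_trans (deltal (restriction H (vertices_neq0 H)) _) => //.
  exact: induced_restriction.
have colH : colorable H (Num.truncn l).+1.
  apply: greedy_colorable => // W W0 /(induced_restriction W0) indW.
  have [v vW dv] := hdeg _ indW; exists v => //.
  by rewrite -dv truncn_ge_nat // deltal.
rewrite /chromatic_number; case: ex_minnP => m _ /(_ _ colH) mle.
apply: le_trans (_ : (Num.truncn l).+1%:R <= _); first by rewrite ler_nat.
by rewrite -addn1 natrD addrC lerD2l truncn_le.
Qed.
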